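(* Let $G_A$ and $G_B$ be undirected vertex-labeled invertible graphs without loops on $n$ and $m$ vertices, with adjacency matrices $A$ and $B$, respectively. Assume that $G_B$ is arbitrarily bridgeable over its first $k_B$ vertices $\{1,\dots,k_B\}$. Let $K$ be an $n\times m$ matrix with entries in $\{0,1\}$ whose last $m-k_B$ columns are zero, i.e. $K_{ij}=0$ for $j=k_B+1,\dots,m$. Then $KB^{-1}K^T=0$ and, consequently, the Schur complement $S=A-KB^{-1}K^T$ satisfies $S=A$ and $S^{-1}=A^{-1}$. Moreover, the HOMO-LUMO spectral gap $\Lambda_{HL}(G_C)$ of the bridged graph $G_C=\mathcal{B}_K(G_A,G_B)$ is the optimal value of the semidefinite programming problem $$\Lambda_{HL}(G_C)=\max_{\mu,\eta\ge 0}\ \mu+\eta$$ subject to $$\begin{pmatrix} I-\mu A^{-1} & KB^{-1}\\ B^{-1}K^T & I-\mu B^{-1}+B^{-1}K^TKB^{-1}\end{pmatrix}\succeq 0,$$ $$\begin{pmatrix} I+\eta A^{-1} & KB^{-1}\\ B^{-1}K^T & I+\eta B^{-1}+B^{-1}K^TKB^{-1}\end{pmatrix}\succeq 0.$$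
   Context: A graph is invertible if its (symmetric $0/1$) adjacency matrix is invertible. HOMO-LUMO spectral gap: for a graph $G_C$ with adjacency matrix $C$, $\Lambda_{HL}(G_C)=\check\lambda^+(G_C)-\hat\lambda^-(G_C)$, where $\check\lambda^+(G_C)\ge 0$ is the smallest nonnegative eigenvalue and $\hat\lambda^-(G_C)\le 0$ is the largest nonpositive eigenvalue of $C$ (so for invertible $G_C$ these are the smallest positive and the largest negative eigenvalues). Arbitrarily bridgeable: an undirected vertex-labeled graph $G_B$ on $m$ vertices with invertible adjacency matrix $B$ is arbitrarily bridgeable over its first $\{1,\dots,k_B\}$ vertices if the upper-left $k_B\times k_B$ principal submatrix of $B^{-1}$ is the zero matrix. Bridged graph: for an $n\times m$ matrix $K$ with entries in $\{0,1\}$ (describing an $(n,m)$-bipartite graph $G_K$ with adjacency matrix $\begin{pmatrix} 0 & K \\ {K^T} & 0 \end{pmatrix}$), $\mathcal{B}_K(G_A,G_B)$ is the graph on $n+m$ vertices with adjacency matrix $C=\begin{pmatrix} A & K\\ K^T & B\end{pmatrix}$. $M\succeq 0$ means that the symmetric matrix $M$ is positive semidefinite; $I$ denotes an identity matrix of the appropriate size. *)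

(* Defs.v *)
From HB Require Import structures.
From mathcomp Require Import all_boot all_order all_algebra.

Set Implicit Arguments.
Unset Strict Implicit.
Unset Printing Implicit Defensive.

Import Order.TTheory GRing.Theory Num.Theory.
Local Open Scope ring_scope.

(* The scalars form an arbitrary real closed field R; the real numbers are an
   instance.  A vertex-labeled graph on n vertices is identified with its
   adjacency matrix; vertices are the elements of 'I_n, hence numbered from 0,
   so the paper's vertices 1, ..., k are the i : 'I_n with i < k. *)

Definition zero_one_mx (R : rcfType) (n m : nat) (M : 'M[R]_(n, m)) : Prop :=
  forall i j, M i j = 0 \/ M i j = 1.

Definition graph_adjacency (R : rcfType) (n : nat) (A : 'M[R]_n) : Prop :=
  zero_one_mx A /\ A^T = A.

Definition loopless (R : rcfType) (n : nat) (A : 'M[R]_n) : Prop :=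
  forall i, A i i = 0.

Definition invertible_graph (R : rcfType) (n : nat) (A : 'M[R]_n) : Prop :=
  A \in unitmx.

Definition ul_principal (R : rcfType) (m k : nat) (lekm : (k <= m)%N)
    (M : 'M[R]_m) : 'M[R]_k :=
  mxsub (widen_ord lekm) (widen_ord lekm) M.

Definition arbitrarily_bridgeable (R : rcfType) (m k : nat) (lekm : (k <= m)%N)
    (B : 'M[R]_m) : Prop :=
  invertible_graph B /\ ul_principal lekm (invmx B) = 0.

Definition bridged (R : rcfType) (n m : nat)
    (A : 'M[R]_n) (B : 'M[R]_m) (K : 'M[R]_(n, m)) : 'M[R]_(n + m) :=
  block_mx A K K^T B.

Definition schur_complement (R : rcfType) (n m : nat)
    (A : 'M[R]_n) (B : 'M[R]_m) (K : 'M[R]_(n, m)) : 'M[R]_n :=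
  A - K *m invmx B *m K^T.

Definition smallest_nonneg_eigenvalue (R : rcfType) (n : nat)
    (C : 'M[R]_n) (a : R) : Prop :=
  [/\ eigenvalue C a, 0 <= a
    & forall b, eigenvalue C b -> 0 <= b -> a <= b].

Definition largest_nonpos_eigenvalue (R : rcfType) (n : nat)
    (C : 'M[R]_n) (a : R) : Prop :=
  [/\ eigenvalue C a, a <= 0
    & forall b, eigenvalue C b -> b <= 0 -> b <= a].

(* A relation rather than a function, since a matrix need not have eigenvalues
   of both signs; the gap is unique when it exists (homo_lumo_gap_unique). *)
Definition homo_lumo_gap (R : rcfType) (n : nat) (C : 'M[R]_n) (L : R) : Prop :=
  exists lp lm : R,
    [/\ smallest_nonneg_eigenvalue C lp, largest_nonpos_eigenvalue C lm
      & L = lp - lm].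

Lemma homo_lumo_gap_unique (R : rcfType) (n : nat) (C : 'M[R]_n) (L L' : R) :
  homo_lumo_gap C L -> homo_lumo_gap C L' -> L = L'.
Proof.
move=> [p [q [[ep p0 pmin] [eq q0 qmax] ->]]].
move=> [p' [q' [[ep' p0' pmin'] [eq' q0' qmax'] ->]]].
have -> : p = p' by apply/le_anti; rewrite pmin ?pmin'.
by have -> : q = q' by apply/le_anti; rewrite qmax ?qmax'.
Qed.

Definition psd (R : rcfType) (n : nat) (M : 'M[R]_n) : Prop :=
  M^T = M /\ forall x : 'cV[R]_n, 0 <= (x^T *m M *m x) 0 0.

(* The matrix of both constraints: the first at t = mu, the second at
   t = - eta. *)
Definition constraint_mx (R : rcfType) (n m : nat)
    (A : 'M[R]_n) (B : 'M[R]_m) (K : 'M[R]_(n, m)) (t : R) : 'M[R]_(n + m) :=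
  block_mx
    (1%:M - t *: invmx A) (K *m invmx B)
    (invmx B *m K^T)      (1%:M - t *: invmx B + invmx B *m K^T *m K *m invmx B).

Definition sdp_feasible (R : rcfType) (n m : nat)
    (A : 'M[R]_n) (B : 'M[R]_m) (K : 'M[R]_(n, m)) (mu eta : R) : Prop :=
  [/\ 0 <= mu, 0 <= eta,
      psd (constraint_mx A B K mu) & psd (constraint_mx A B K (- eta))].

Definition sdp_maximum (R : rcfType) (n m : nat)
    (A : 'M[R]_n) (B : 'M[R]_m) (K : 'M[R]_(n, m)) (L : R) : Prop :=
  (exists mu eta, sdp_feasible A B K mu eta /\ mu + eta = L) /\
  (forall mu eta, sdp_feasible A B K mu eta -> mu + eta <= L).

(* Main.v *)
(* Since K B^-1 K^T = 0, the matrix C of the bridged graph factors as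
   C = U diag(A, B) U^T with U = [[I, K B^-1], [0, I]], so C is invertible and
   the constraint matrix at t is the congruent image U^T (I - t C^-1) U.  By the
   spectral theorem it is positive semidefinite iff t / l <= 1 for every
   eigenvalue l of C: mu ranges up to the least positive eigenvalue and - eta
   down to the greatest negative one.  Both exist because a nonzero
   semidefinite matrix cannot have a zero diagonal. *)
Require Import Defs.
From mathcomp Require Import all_boot all_order all_algebra.
From mathcomp Require Import complex lra.

Set Implicit Arguments.
Unset Strict Implicit.
Unset Printing Implicit Defensive.

Import Order.TTheory GRing.Theory Num.Theory.
Local Open Scope ring_scope.

(** * Spectral theorem for symmetric matrices over a real closed field *)

Lemma eigenvalue_diag_mx (F : fieldType) (n : nat) (d : 'rV[F]_n) (a : F) :
  eigenvalue (diag_mx d) a <-> exists i, a = d 0 i.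
Proof.
split=> [/eigenvalueP[v + /rV0Pn[i vi]] | [i ->]].
  move=> /rowP/(_ i); rewrite mul_mx_diag !mxE mulrC => /(mulIf vi) <-.
  by exists i.
apply/eigenvalueP; exists (delta_mx 0 i).
  apply/rowP => j; rewrite mul_mx_diag !mxE eqxx /=.
  by case: eqP => [->|_]; rewrite ?mulr0 ?mul0r // mulrC.
by apply/rV0Pn; exists i; rewrite mxE !eqxx oner_eq0.
Qed.

Lemma eigenvalue_invmx_conj (F : fieldType) (n : nat) (P M : 'M[F]_n) (a : F) :
  P \in unitmx -> eigenvalue (invmx P *m M *m P) a = eigenvalue M a.
Proof.
move=> uP.
have nzM v Q : Q \in unitmx -> v != 0 -> v *m Q != 0 :> 'rV[F]_n.
  by move=> uQ; rewrite mulmx_free_eq0 ?row_free_unit.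
apply/eigenvalueP/eigenvalueP => -[v ev v0].
  exists (v *m invmx P); last by rewrite nzM ?unitmx_inv.
  by rewrite scalemxAl -ev !mulmxA mulmxK.
exists (v *m P); last exact: nzM.
by rewrite !mulmxA mulmxK // ev scalemxAl.
Qed.

(** The inverse of the unitary matrix [spectralmx M] is its conjugate transpose, so diagonalising
    [M] rewrites the form in the coordinates [spectralmx M *m x]. *)
Lemma hermsym_form_spectral (C : numClosedFieldType) (n : nat) (M : 'M[C]_n)
    (x : 'cV[C]_n) : M \is hermsymmx ->
  (map_mx Num.conj x^T *m M *m x) 0 0 =
    \sum_i spectral_diag M 0 i * `|(spectralmx M *m x) i 0| ^+ 2.
Proof.
move=> /hermitian_normalmx/orthomx_spectralP ME.
rewrite {1}ME invmx_unitary ?spectral_unitarymx // !mulmxA -map_mxM -trmx_mul.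
rewrite -[_ *m spectralmx M *m x]mulmxA; set z := spectralmx M *m x.
rewrite mxE; apply: eq_bigr => i _.
rewrite mul_mx_diag mxE [_ 0 i]mxE [z^T _ _]mxE.
by rewrite normCK mulrAC mulrC [z i 0 * _]mulrC.
Qed.

(** The matrix is diagonalised over [R[i]], where it is Hermitian, and the result is brought back to
    [R]. The weights [w] stand for the squared moduli of the complex coordinates of [x]; their
    nonnegativity is enough to read signs of the form off the eigenvalues. *)
Lemma symmetric_spectral (R : rcfType) (n : nat) (M : 'M[R]_n) : M^T = M ->
  exists d : 'rV[R]_n, (forall a, eigenvalue M a <-> exists i, a = d 0 i) /\
    forall x : 'cV[R]_n, exists2 w : 'I_n -> R, (forall i, 0 <= w i) &
      (x^T *m M *m x) 0 0 = \sum_i d 0 i * w i.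
Proof.
move=> symM; pose toC := real_complex R; pose MC := map_mx toC M.
have hermMC : MC \is hermsymmx.
  apply: realsym_hermsym.
    apply/is_hermitianmxP; rewrite expr0 scale1r map_mx_id //.
    by rewrite /MC map_trmx symM.
  by apply/mxOverP => i j; rewrite mxE complex_real.
have /orthomx_spectralP := hermitian_normalmx hermMC.
set P := spectralmx MC => MCE.
pose d := map_mx (@complex.Re R) (spectral_diag MC).
(* Eigenvalues of a Hermitian matrix are real, so taking real parts loses nothing. *)
have dE : spectral_diag MC = map_mx toC d.
  apply/rowP => i; rewrite !mxE /toC RRe_real //.
  exact: (mxOverP (hermitian_spectral_diag_real hermMC)).
exists d; split=> [a|x].
  rewrite -(eigenvalue_map toC) -/MC MCE.
  rewrite eigenvalue_invmx_conj ?spectral_unit // dE (eigenvalue_diag_mx _ (toC a)).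
  split=> -[i ai]; exists i; last by rewrite mxE ai.
  by move: ai; rewrite mxE => /complexI.
pose z := spectralmx MC *m map_mx toC x.
exists (fun i => complex.Re (z i 0) ^+ 2 + complex.Im (z i 0) ^+ 2) => [i|].
  by rewrite addr_ge0 ?sqr_ge0.
apply: (@complexI R).
have conjx : map_mx Num.conj (map_mx toC x)^T = map_mx toC x^T.
  by apply/matrixP => i j; rewrite !mxE conj_Creal // complex_real.
transitivity ((map_mx toC (x^T *m M *m x)) 0 0); first by rewrite [RHS]mxE.
rewrite !map_mxM -conjx -/MC hermsym_form_spectral // rmorph_sum /=.
apply: eq_bigr => i _.
by rewrite rmorphM /= add_Re2_Im2 dE mxE.
Qed.

(** * Semidefiniteness, eigenvalues and zero diagonals *)

Lemma eigenvalueN (F : fieldType) (n : nat) (M : 'M[F]_n) (a : F) :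
  eigenvalue (- M) a = eigenvalue M (- a).
Proof.
apply/eigenvalueP/eigenvalueP => -[v ev v0]; exists v => //.
  by rewrite scaleNr -ev mulmxN opprK.
by rewrite mulmxN ev scaleNr opprK.
Qed.

Lemma eigenvalue_unitmx_neq0 (F : fieldType) (n : nat) (M : 'M[F]_n) (a : F) :
  M \in unitmx -> eigenvalue M a -> a != 0.
Proof.
move=> uM /eigenvalueP[v ev v0]; apply: contraNneq v0 => a0.
by rewrite -[v](mulmxK uM) ev a0 scale0r mul0mx.
Qed.

(** At the transpose of a left eigenvector [v] the form equals [a] times the positive number
    [v *m v^T]. Conversely, the form is a combination of eigenvalues with nonnegative weights. *)
Lemma psd_eigenvalueP (R : rcfType) (n : nat) (M : 'M[R]_n) : M^T = M ->
  psd M <-> (forall a, eigenvalue M a -> 0 <= a).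
Proof.
move=> symM; split=> [[_ psdM] a /eigenvalueP[v ev v0] | ge0].
  have := psdM v^T; rewrite trmxK ev -scalemxAl mxE.
  suff v_gt0 : 0 < (v *m v^T) 0 0 by rewrite pmulr_lge0.
  have [i vi] := rV0Pn _ v0.
  rewrite mxE (bigD1 i) //= mxE ltr_pwDl //.
    by rewrite -expr2 exprn_even_gt0.
  by apply: sumr_ge0 => j _; rewrite mxE -expr2 sqr_ge0.
split=> // x; have [d [eigd /(_ x)[w w0 ->]]] := symmetric_spectral symM.
apply: sumr_ge0 => i _; rewrite mulr_ge0 // ge0 //.
by apply/eigd; exists i.
Qed.

Lemma psd_congr (R : rcfType) (n : nat) (U M : 'M[R]_n) : U \in unitmx ->
  psd (U^T *m M *m U) <-> psd M.
Proof.
have congr (V N : 'M[R]_n) : psd N -> psd (V^T *m N *m V).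
  move=> [symN psdN]; split; first by rewrite !trmx_mul trmxK symN mulmxA.
  by move=> x; have := psdN (V *m x); rewrite trmx_mul !mulmxA.
move=> uU; split; last exact: congr.
move=> /(congr (invmx U)).
by rewrite !mulmxA -trmx_mul mulmxV // trmx1 mul1mx mulmxK.
Qed.

(** With a zero diagonal, the form at [e i + s *: e j] is [2 * s * M i j]; the choices [s = 1] and
    [s = -1] force the entry to vanish. *)
Lemma psd_diag0 (R : rcfType) (n : nat) (M : 'M[R]_n) :
  psd M -> (forall i, M i i = 0) -> M = 0.
Proof.
move=> [symM psdM] diag0; apply/matrixP => i j; rewrite [RHS]mxE.
pose e k : 'cV[R]_n := delta_mx k 0.
have entry k l : (e k)^T *m M *m e l = (M k l)%:M.
  by rewrite [LHS]mx11_scalar trmx_delta -rowE -colE !mxE.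
have symij : M j i = M i j by rewrite -[in LHS]symM mxE.
have quad s : 0 <= s * M i j.
  have := psdM (e i + s *: e j).
  rewrite [(_ + _)^T]linearD /= [(_ *: _)^T]linearZ /= !mulmxDl !mulmxDr.
  rewrite -!scalemxAl -!scalemxAr.
  by rewrite !entry !diag0 symij !mxE /= !mulr1n; lra.
by apply/le_anti; have := quad 1; have := quad (-1); rewrite mulN1r mul1r; lra.
Qed.

(** Without a positive eigenvalue, [- C] would be semidefinite with zero diagonal, hence zero. *)
Lemma loopless_eigenvalue_gt0 (R : rcfType) (n : nat) (C : 'M[R]_n) :
  C^T = C -> loopless C -> C != 0 -> exists2 a, eigenvalue C a & 0 < a.
Proof.
move=> symC looplessC C0; have [d [eigd _]] := symmetric_spectral symC.
have [/existsP[i di]|/existsPn all_le0] := boolP [exists i, 0 < d 0 i].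
  by exists (d 0 i) => //; apply/eigd; exists i.
case/eqP: C0; apply: oppr_inj; rewrite oppr0; apply: psd_diag0.
  apply/psd_eigenvalueP => [|a]; first by rewrite linearN /= symC.
  rewrite eigenvalueN => /eigd[i ai].
  by rewrite -oppr_le0 ai leNgt.
by move=> i; rewrite mxE looplessC oppr0.
Qed.

(** The eigenvalues are the entries of a finite row, and [a] shows that the minimum over the
    nonnegative ones is not taken over the empty set. *)
Lemma smallest_nonneg_eigenvalue_exists (R : rcfType) (n : nat) (C : 'M[R]_n)
    (a : R) :
  C^T = C -> eigenvalue C a -> 0 <= a ->
  exists b, smallest_nonneg_eigenvalue C b.
Proof.
move=> symC + a0; have [d [eigd _]] := symmetric_spectral symC.
move=> /eigd[i0 ai0].
have di0 : 0 <= d 0 i0 by rewrite -ai0.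
case: (@Order.TotalTheory.arg_minP _ _ _ i0 (fun i => 0 <= d 0 i)
        (fun i => d 0 i) di0) => i di imin.
exists (d 0 i); split=> // [|b /eigd[j ->] dj]; last exact: imin.
by apply/eigd; exists i.
Qed.

Lemma largest_nonpos_eigenvalueN (R : rcfType) (n : nat) (C : 'M[R]_n) (a : R) :
  smallest_nonneg_eigenvalue (- C) a -> largest_nonpos_eigenvalue C (- a).
Proof.
move=> [eiga a0 amin]; split; rewrite -?eigenvalueN ?oppr_le0 // => b eigb b0.
by rewrite lerNr amin ?eigenvalueN ?opprK ?oppr_ge0.
Qed.

(** The eigenvalues of [1%:M - t *: invmx C] are the numbers [1 - t / l] with [l] an eigenvalue of
    [C]. *)
Lemma psd_sub_scale_invmx (R : rcfType) (n : nat) (C : 'M[R]_n) (t : R) :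
  C^T = C -> C \in unitmx ->
  psd (1%:M - t *: invmx C) <-> (forall l, eigenvalue C l -> t / l <= 1).
Proof.
move=> symC uC.
have symM : (1%:M - t *: invmx C)^T = 1%:M - t *: invmx C.
  by rewrite linearB linearZ /= trmx1 trmx_inv symC.
rewrite psd_eigenvalueP //; split=> [ge0 l eigl | le1 a /eigenvalueP[v ev v0]].
  have l0 := eigenvalue_unitmx_neq0 uC eigl.
  have /eigenvalueP[v ev v0] := eigl.
  rewrite -subr_ge0; apply: ge0; apply/eigenvalueP; exists v => //.
  have vCV : v *m invmx C = l^-1 *: v.
    by rewrite -[v in RHS](mulmxK uC) ev -scalemxAl scalerA mulVf // scale1r.
  by rewrite mulmxBr mulmx1 -scalemxAr vCV scalerBl scale1r scalerA.
(* Multiplying the eigenvector equation by [C] on the right removes the inverse: for [a != 1], [v]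
   is then an eigenvector of [C] for [l = t / (1 - a)], and [t / l <= 1] reads [0 <= a]. *)
have evC : (1 - a) *: (v *m C) = t *: v.
  apply/eqP; rewrite scalerBl scale1r subr_eq addrC -subr_eq; apply/eqP.
  by rewrite scalemxAl -ev mulmxBr mulmx1 -scalemxAr mulmxBl -scalemxAl mulmxKV.
have [-> | a1] := eqVneq a 1; first exact: ler01.
have a1' : 1 - a != 0 by rewrite subr_eq0 eq_sym.
have eigl : eigenvalue C (t / (1 - a)).
  apply/eigenvalueP; exists v => //.
  by rewrite mulrC -scalerA -evC scalerA mulVf // scale1r.
(* Since [l] is nonzero, so is [t], which makes [t / l] equal to [1 - a]. *)
have := eigenvalue_unitmx_neq0 uC eigl; rewrite mulf_eq0 negb_or => /andP[t0 _].
by have := le1 _ eigl; rewrite invf_div mulrC divfK //; lra.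
Qed.

(** * Congruence between the constraint matrices and the inverse of the bridged matrix *)

Section Bridged.
Variables (R : rcfType) (n m : nat) (A : 'M[R]_n) (B : 'M[R]_m).
Variable K : 'M[R]_(n, m).
Hypotheses (symA : A^T = A) (symB : B^T = B).
Hypotheses (uA : A \in unitmx) (uB : B \in unitmx).
Hypothesis KBK0 : K *m invmx B *m K^T = 0.

Let U : 'M[R]_(n + m) := block_mx 1%:M (K *m invmx B) 0 1%:M.
Let D : 'M[R]_(n + m) := block_mx A 0 0 B.

Let uU : U \in unitmx.
Proof. by rewrite unitmxE det_ublock !det1 mulr1 unitr1. Qed.

Let uD : D \in unitmx.
Proof. by rewrite unitmxE det_ublock unitrM -!unitmxE uA uB. Qed.

Let trU : U^T = block_mx 1%:M 0 (invmx B *m K^T) 1%:M.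
Proof. by rewrite /U tr_block_mx !trmx1 trmx0 trmx_mul trmx_inv symB. Qed.

(** The upper-left block of the product is [A + K *m invmx B *m K^T], which [KBK0] reduces to
    [A]. *)
Let bridgedE : bridged A B K = U *m D *m U^T.
Proof.
rewrite trU !mulmx_block !mul1mx !mulmx1 !mulmx0 !mul0mx !addr0 !add0r.
by rewrite !mulmxA mulmxKV // KBK0 addr0 mulmxV // mul1mx.
Qed.

Lemma bridged_unitmx : bridged A B K \in unitmx.
Proof. by rewrite bridgedE !unitmx_mul unitmx_tr uU uD. Qed.

Lemma bridged_sym : (bridged A B K)^T = bridged A B K.
Proof. by rewrite tr_block_mx trmxK symA symB. Qed.

(** The terms free of [t] form [U^T *m U], and those in [t] form
    [U^T *m invmx (bridged A B K) *m U], which is the block diagonal [invmx D]. *)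
Lemma constraint_mx_congr (t : R) :
  constraint_mx A B K t = U^T *m (1%:M - t *: invmx (bridged A B K)) *m U.
Proof.
rewrite mulmxBr mulmx1 mulmxBl -scalemxAr -scalemxAl.
have -> : U^T *m invmx (bridged A B K) *m U = invmx D.
  have uUT : U^T \in unitmx by rewrite unitmx_tr.
  have UD : U *m D = bridged A B K *m invmx U^T by rewrite bridgedE mulmxK.
  (* After multiplication by [D] on the right, [UD] cancels the inverse of the bridged matrix and
     leaves [U^T *m invmx U^T]. *)
  apply: (can_inj (mulmxK uD)); rewrite mulVmx // -!mulmxA UD.
  by rewrite mulKmx ?bridged_unitmx // mulmxV.
have -> : invmx D = block_mx (invmx A) 0 0 (invmx B).
  by rewrite invmx_block_diag ?unitmxE -?/D.
rewrite trU mulmx_block !mul1mx !mulmx1 !mul0mx !addr0 mulmxA.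
rewrite scale_block_mx opp_block_mx add_block_mx !scaler0 !oppr0 !addr0.
rewrite /constraint_mx [X in block_mx _ _ _ X]addrAC.
by rewrite [1%:M + _ *m invmx B]addrC.
Qed.

Lemma psd_constraint_mx (t : R) :
  psd (constraint_mx A B K t) <->
  (forall l, eigenvalue (bridged A B K) l -> t / l <= 1).
Proof.
rewrite constraint_mx_congr psd_congr //.
exact: psd_sub_scale_invmx bridged_sym bridged_unitmx.
Qed.

End Bridged.

(** * Vanishing of the correction term, and the optimal value *)

(** An entry of the product sums terms [K i l * M l j * K i' j]: a factor from [K] vanishes when [l]
    or [j] is at least [k], and otherwise [M l j] lies in the zero block. *)
Lemma mulmx_ul_principal0 (R : rcfType) (n m k : nat) (lekm : (k <= m)%N)
    (M : 'M[R]_m) (K : 'M[R]_(n, m)) :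
  ul_principal lekm M = 0 ->
  (forall (i : 'I_n) (j : 'I_m), (k <= j)%N -> K i j = 0) ->
  K *m M *m K^T = 0.
Proof.
move=> M0 K0; apply/matrixP => i i'; rewrite !mxE big1 // => j _.
rewrite !mxE; have [kj|jk] := leqP k j; first by rewrite (K0 i' j) ?mulr0.
rewrite big1 ?mul0r // => l _.
have [kl|lk] := leqP k l; first by rewrite K0 ?mul0r.
have /matrixP/(_ (Ordinal lk) (Ordinal jk)) := M0; rewrite !mxE => Mlj.
suff -> : M l j = 0 by rewrite mulr0.
by rewrite -Mlj; congr (M _ _); apply: val_inj.
Qed.

Lemma homo_lumo_gap_sdp_maximum (R : rcfType) (n m : nat) (A : 'M[R]_n)
    (B : 'M[R]_m) (K : 'M[R]_(n, m)) : (0 < n + m)%N ->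
  A^T = A -> B^T = B -> loopless A -> loopless B ->
  A \in unitmx -> B \in unitmx -> K *m invmx B *m K^T = 0 ->
  exists L : R, homo_lumo_gap (bridged A B K) L /\ sdp_maximum A B K L.
Proof.
move=> nm_gt0 symA symB loopA loopB uA uB KBK0.
have feasP := psd_constraint_mx symA symB uA uB KBK0.
have symC := bridged_sym K symA symB; have uC := bridged_unitmx symB uA uB KBK0.
set C := bridged A B K in feasP symC uC *.
have symNC : (- C)^T = - C by rewrite linearN /= symC.
have loopC : loopless C.
  by move=> i; case: (split_ordP i) => j ->; rewrite ?block_mxEul ?block_mxEdr.
(* Positive dimension matters here: the empty matrix is both zero and invertible. *)
have C0 : C != 0.
  apply: contraTneq uC => ->.
  by rewrite -row_free_unit /row_free mxrank0 eq_sym -lt0n.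
have loopNC : loopless (- C) by move=> i; rewrite mxE loopC oppr0.
have NC0 : - C != 0 by rewrite oppr_eq0.
have [p [eigp p0 pmin]] : exists p, smallest_nonneg_eigenvalue C p.
  have [a eiga /ltW a0] := loopless_eigenvalue_gt0 symC loopC C0.
  exact: smallest_nonneg_eigenvalue_exists eiga a0.
(* The matrix [- C] is again symmetric, nonzero and of zero diagonal, so the previous argument
   applies to it, and negation turns its least nonnegative eigenvalue into [q]. *)
have [q [eigq q0 qmax]] : exists q, largest_nonpos_eigenvalue C q.
  have [a eiga /ltW a0] := loopless_eigenvalue_gt0 symNC loopNC NC0.
  have [b bmin] := smallest_nonneg_eigenvalue_exists symNC eiga a0.
  by exists (- b); apply: largest_nonpos_eigenvalueN.
have p_gt0 : 0 < p by rewrite lt_def (eigenvalue_unitmx_neq0 uC eigp).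
have q_lt0 : q < 0 by rewrite lt_def eq_sym (eigenvalue_unitmx_neq0 uC eigq).
have eig_dichotomy l : eigenvalue C l -> (l < 0 /\ l <= q) \/ (0 < l /\ p <= l).
  move=> eigl; have := eigenvalue_unitmx_neq0 uC eigl.
  case: ltgtP => // l0 _; [left|right]; split=> //.
    by rewrite qmax // ltW.
  by rewrite pmin // ltW.
exists (p - q); split; first by exists p, q; split.
(* For the upper bound, the criterion at [l = p] gives [mu <= p], and at [l = q < 0] it gives
   [eta <= - q]. *)
split=> [|mu eta [_ _ /feasP/(_ p eigp) mup /feasP/(_ q eigq)]].
  (* The bound is attained: [p / l] is negative or at most [1] according to the sign of [l], and
     likewise [q / l] with the signs exchanged. *)
  exists p, (- q); split=> //; split; rewrite ?oppr_ge0 //; apply/feasP => l.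
    move=> /eig_dichotomy[[l0 _]|[l0 pl]].
      by rewrite ler_ndivrMr // mul1r (le_trans (ltW l0)).
    by rewrite ler_pdivrMr // mul1r.
  move=> /eig_dichotomy[[l0 lq]|[l0 _]].
    by rewrite opprK ler_ndivrMr // mul1r.
  by rewrite opprK ler_pdivrMr // mul1r (le_trans q0) // ltW.
by move: mup; rewrite ler_pdivrMr // ler_ndivrMr // !mul1r; lra.
Qed.

(** The hypothesis [nm_gt0] excludes the empty graph, whose matrix has no eigenvalue and hence no
    gap. *)
Theorem theorem3p3 (R : rcfType) (n m kB : nat) (nm_gt0 : (0 < n + m)%N)
    (lekm : (kB <= m)%N)
    (A : 'M[R]_n) (B : 'M[R]_m) (K : 'M[R]_(n, m))
    (graphA : graph_adjacency A) (looplessA : loopless A)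
    (invA : invertible_graph A)
    (graphB : graph_adjacency B) (looplessB : loopless B)
    (invB : invertible_graph B)
    (bridgeableB : arbitrarily_bridgeable lekm B)
    (K01 : zero_one_mx K)
    (K_last0 : forall (i : 'I_n) (j : 'I_m), (kB <= j)%N -> K i j = 0) :
  [/\ K *m invmx B *m K^T = 0,
      schur_complement A B K = A,
      invmx (schur_complement A B K) = invmx A
    & exists L : R, homo_lumo_gap (bridged A B K) L /\ sdp_maximum A B K L].
Proof.
have [_ ulB0] := bridgeableB; have [_ symA] := graphA; have [_ symB] := graphB.
have KBK0 := mulmx_ul_principal0 ulB0 K_last0.
have schurA : schur_complement A B K = A by rewrite /schur_complement KBK0 subr0.
split; rewrite ?schurA //.
exact: homo_lumo_gap_sdp_maximum.
Qed.
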